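(* Let $0<\alpha,\beta<1$, let $r$ be an arbitrary (nonzero) parameter, and consider the variable coefficient nonlinear space-time fractional Burgers' equation $$u_t^{(\alpha)} = f(t)\,u_x^{(2\beta)} + g(t)\,\bigl(u_x^{(\beta)}\bigr)^2,\qquad x\in(0,\infty),\ t>0,$$ where $g(t)=k f(t)$ with $k$ a nonzero constant. Let $F(t)$ be a function with $F_t^{(2\alpha)}=f(t)$. Under the group of transformations $$\gamma(x,t)=\frac{x^\beta}{\Gamma(1+\beta)},\qquad \rho(\gamma)=-\frac{\Gamma(1+\alpha)}{r}\,u+F_t^{(\alpha)},$$ the Burgers' equation reduces to the nonlinear ordinary differential equation $$\rho''(\gamma)-\frac{kr}{\Gamma(1+\alpha)}\bigl(\rho'(\gamma)\bigr)^2+1=0,$$ which has the general solution $$u(x,t)=F_t^{(\alpha)}+\frac1k\log\left[\cosh\left\{\sqrt{k}\left(c_3+\frac{x^\beta}{\Gamma(1+\beta)}\right)\right\}\right]-c_4,$$ where $c_3$ and $c_4$ are arbitrary constants.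
   Context: Fractional derivatives are Jumarie's modified Riemann-Liouville derivatives: for $0<\alpha<1$, $$D_x^\alpha h(x)=\frac{1}{\Gamma(1-\alpha)}\frac{d}{dx}\int_0^x (x-s)^{-\alpha}\bigl(h(s)-h(0)\bigr)\,ds.$$ Notation: $u_t^{(\alpha)}=D_t^\alpha u$, $u_x^{(\beta)}=D_x^\beta u$, $u_x^{(2\beta)}=D_x^\beta D_x^\beta u$; similarly $F_t^{(\alpha)}=D_t^\alpha F$ and $F_t^{(2\alpha)}=D_t^\alpha D_t^\alpha F$. The coefficients $f,g$ are given functions of $t$. A prime denotes the ordinary derivative with respect to the argument $\gamma$. The paper adopts the following calculus rules for this derivative and uses them throughout: the product rule $D_x^\alpha(uv)=(D_x^\alpha u)v+u(D_x^\alpha v)$; the chain rule $D_t^\alpha h(x(t))=\frac{dh}{dx}\,D_t^\alpha x(t)$ for $0<\alpha<1$ provided $\frac{dh}{dx}$ exists; and the power rule $D_x^\alpha x^\beta=\frac{\Gamma(1+\beta)}{\Gamma(1+\beta-\alpha)}x^{\beta-\alpha}$. ''Reduces to'' means that substituting the given form of $u$ into the Burgers' equation, using these rules, yields the stated equation for the function of the similarity variable.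
   Formalization: The printed u is the general solution of the ODE only for r=Γ(1+α) (a rescaled formula is given for other r) and without the singular linear ρ; Burgers ⇒ ODE needs f not identically 0; as the rules are inconsistent for Jumarie's derivative, any derivative obeying the rules needed is taken. *)

(* Defs.v *)
From Stdlib Require Import Reals Lra.
From Coquelicot Require Import Coquelicot.
Open Scope R_scope.

Definition Gamma (z : R) : R :=
  RInt_gen (fun t => Rpower t (z - 1) * exp (- t))
    (at_right 0) (Rbar_locally p_infty).

(* [Rpower 0 b] is [1] in the standard library; the value at the origin enters
   Jumarie's derivative through [h 0], so it is set to [0] here. *)
Definition pw (b x : R) : R := if Rlt_dec 0 x then Rpower x b else 0.

(* The integral over (0,y) is improper at both ends. *)
Definition jumarie_integrand (a : R) (h : R -> R) (y s : R) : R :=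
  Rpower (y - s) (- a) * (h s - h 0).

(* [is_jumarie a h x l]: Jumarie's modified Riemann-Liouville derivative of
   order [a] of [h] exists at [x] and equals [l]. *)
Definition is_jumarie (a : R) (h : R -> R) (x l : R) : Prop :=
  locally x (fun y =>
    ex_RInt_gen (jumarie_integrand a h y) (at_right 0) (at_left y)) /\
  is_derive (fun y => / Gamma (1 - a) *
    RInt_gen (jumarie_integrand a h y) (at_right 0) (at_left y)) x l.

Definition jumarie_power_rule : Prop :=
  forall a b x : R, 0 < a < 1 -> 0 < b -> 0 < x ->
    is_jumarie a (pw b) x (Gamma (1 + b) / Gamma (1 + b - a) * pw (b - a) x).

(* [D a h x l] reads "the derivative of order [a] of [h] at [x] is [l]".
   The product and chain rules fail for [is_jumarie] as it stands: together
   with the power rule they would give, for the square of the identity, both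
   2 x^(2-a) / Gamma (2-a) and 2 x^(2-a) / Gamma (3-a).  Assuming them of
   [is_jumarie] itself would therefore be contradictory.  Instead, [D] is any
   derivative that obeys them and takes the value of Jumarie's derivative on
   x^a, the power whose order matches.  By the chain rule it then also agrees
   with it on all c0 + c1 x^a.  Lemma [jumarie_calculus_consistent] below
   exhibits such a [D]. *)
Record jumarie_calculus (D : R -> (R -> R) -> R -> R -> Prop) : Prop := {
  jc_unique : forall a h x l1 l2, 0 < a < 1 -> 0 < x ->
    D a h x l1 -> D a h x l2 -> l1 = l2;
  jc_ext : forall a h1 h2 x l, 0 < a < 1 -> 0 < x ->
    (forall s, 0 <= s -> h1 s = h2 s) -> D a h1 x l -> D a h2 x l;
  jc_product : forall a u v x lu lv, 0 < a < 1 -> 0 < x ->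
    D a u x lu -> D a v x lv ->
    D a (fun s => u s * v s) x (lu * v x + u x * lv);
  jc_chain : forall a h y x dh l, 0 < a < 1 -> 0 < x ->
    is_derive h (y x) dh -> D a y x l ->
    D a (fun s => h (y s)) x (dh * l);
  jc_jumarie : forall a x l, 0 < a < 1 -> 0 < x ->
    is_jumarie a (pw a) x l -> D a (pw a) x l
}.

Lemma jumarie_calculus_consistent : jumarie_power_rule ->
  jumarie_calculus (fun a h x l => exists d, is_derive h x d /\
    l = Gamma (1 + a) / Gamma (1 + a - a) / a * Rpower x (1 - a) * d).
Proof.
intros HP; split.
- intros a h x l1 l2 _ _ [d1 [H1 ->]] [d2 [H2 ->]].
  now rewrite <- (is_derive_unique _ _ _ H1), <- (is_derive_unique _ _ _ H2).
- intros a h1 h2 x l _ Hx E [d [Hd ->]]; exists d; split; [|reflexivity].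
  apply (is_derive_ext_loc h1); [|exact Hd].
  exists (mkposreal x Hx); intros y Hy; apply E.
  unfold ball in Hy; simpl in Hy; unfold AbsRing_ball, abs, minus, plus, opp in Hy.
  simpl in Hy; apply Rabs_lt_between in Hy; lra.
- intros a u v x lu lv _ _ [d1 [H1 ->]] [d2 [H2 ->]].
  exists (d1 * v x + u x * d2); split; [|ring].
  apply (is_derive_mult u v x d1 d2 H1 H2); intros; apply Rmult_comm.
- intros a h y x dh l _ _ Hh [d [Hd ->]].
  exists (d * dh); split; [|ring].
  exact (is_derive_comp h y x dh d Hh Hd).
- intros a x l Ha Hx Hl.
  exists (a * Rpower x (a - 1)); split.
  + apply (is_derive_ext_loc (fun s => Rpower s a)).
    * exists (mkposreal x Hx); intros y Hy.
      unfold ball in Hy; simpl in Hy; unfold AbsRing_ball, abs, minus, plus, opp in Hy.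
      simpl in Hy; apply Rabs_lt_between in Hy.
      unfold pw; destruct (Rlt_dec 0 y); [reflexivity | lra].
    * apply is_derive_Reals, derivable_pt_lim_power; exact Hx.
  + pose proof (HP a a x Ha (proj1 Ha) Hx) as Hl'.
    rewrite <- (is_derive_unique _ _ _ (proj2 Hl)).
    rewrite (is_derive_unique _ _ _ (proj2 Hl')).
    unfold pw; destruct (Rlt_dec 0 x); [|lra].
    replace (a - a) with ((1 - a) + (a - 1)) by ring.
    rewrite Rpower_plus.
    unfold Rdiv; rewrite <- !Rmult_assoc.
    replace (Gamma (1 + a) * / Gamma (1 + a - a) * / a * Rpower x (1 - a) * a * Rpower x (a - 1))
      with (Gamma (1 + a) * / Gamma (1 + a - a) * Rpower x (1 - a) * Rpower x (a - 1) * (/ a * a)) by ring.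
    rewrite Rinv_l; lra.
Qed.

Definition space_domain (X : R -> Prop) : Prop :=
  open X /\ forall x, X x -> 0 < x.

(* [u] solves u_t^(alpha) = f u_x^(2 beta) + g (u_x^(beta))^2 for x in [X] and
   t > 0; [ux] is the function u_x^(beta), differentiated a second time. *)
Definition solves_burgers (D : R -> (R -> R) -> R -> R -> Prop)
    (alpha beta : R) (f g : R -> R) (X : R -> Prop) (u : R -> R -> R) : Prop :=
  exists ux : R -> R -> R, forall x t, X x -> 0 < t ->
    D beta (fun y => u y t) x (ux x t) /\
    exists uxx ut : R,
      D beta (fun y => ux y t) x uxx /\
      D alpha (fun s => u x s) t ut /\
      ut = f t * uxx + g t * (ux x t) ^ 2.

Definition similarity_var (beta x : R) : R := pw beta x / Gamma (1 + beta).

(* [Fa] is F_t^(alpha).  The closed quadrant is used because Jumarie's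
   derivative refers to the values at the origin. *)
Definition similarity_form (alpha beta r : R) (Fa : R -> R)
    (u : R -> R -> R) (rho : R -> R) : Prop :=
  forall x t, 0 <= x -> 0 <= t ->
    rho (similarity_var beta x) = - (Gamma (1 + alpha) / r) * u x t + Fa t.

Definition twice_derivable_at (rho : R -> R) (y : R) : Prop :=
  ex_derive rho y /\ ex_derive (Derive rho) y.

Definition reduced_ode (alpha k r : R) (rho : R -> R) (y : R) : Prop :=
  Derive_n rho 2 y - k * r / Gamma (1 + alpha) * (Derive rho y) ^ 2 + 1 = 0.

(* Complex values are needed for sqrt k with k < 0, and for complex constants:
   for k > 0 a c3 with imaginary part pi / (2 sqrt k) turns cosh into i sinh. *)
Definition Cexp (z : C) : C :=
  (exp (Re z) * cos (Im z), exp (Re z) * sin (Im z)).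
Definition Ccosh (z : C) : C := ((Cexp z + Cexp (- z)) / RtoC 2)%C.

(* Principal branch, argument in (-pi, pi]. *)
Definition Carg (z : C) : R :=
  if Rle_dec 0 (Im z) then acos (Re z / Cmod z) else - acos (Re z / Cmod z).
Definition Clog (z : C) : C := (ln (Cmod z), Carg z).

(* Principal root of a real number: [sqrt] vanishes on negative reals. *)
Definition Csqrt (q : R) : C := (sqrt q, sqrt (- q)).

Definition cosh_profile (beta q : R) (c3 : C) (x : R) : C :=
  Ccosh (Csqrt q * (c3 + RtoC (similarity_var beta x)))%C.

Definition burgers_solution (beta k : R) (Fa : R -> R)
    (c3 c4 : C) (x t : R) : C :=
  (RtoC (Fa t) + RtoC (1 / k) * Clog (cosh_profile beta k c3 x) - c4)%C.

(* For r = Gamma (1 + alpha) this is [burgers_solution]. *)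
Definition burgers_solution_r (alpha beta k r : R) (Fa : R -> R)
    (c3 c4 : C) (x t : R) : C :=
  (RtoC (r / Gamma (1 + alpha) * Fa t) +
   RtoC (1 / k) *
     Clog (cosh_profile beta (k * r / Gamma (1 + alpha)) c3 x) - c4)%C.

Definition interval_like (X : R -> Prop) : Prop :=
  forall x y z, X x -> X z -> x <= y <= z -> X y.

(* Under the similarity transformation, the solutions of the reduced equation
   on an interval are the functions [u] of the family [sol], whose logarithm is
   taken of [cosh_profile beta q c3].  The singular solutions rho' = const,
   i.e. q rho'^2 = 1 with q = k r / Gamma (1 + alpha), are limits c3 -> infinity
   outside the two-parameter family and are excluded. *)
Definition is_general_solution (alpha beta k r q : R) (Fa : R -> R)
    (sol : C -> C -> R -> R -> C) : Prop :=
  forall (X : R -> Prop) (u : R -> R -> R) (rho : R -> R) (x0 : R),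
    space_domain X -> interval_like X ->
    similarity_form alpha beta r Fa u rho ->
    (forall x, X x -> twice_derivable_at rho (similarity_var beta x)) ->
    X x0 ->
    k * r / Gamma (1 + alpha) * (Derive rho (similarity_var beta x0)) ^ 2 <> 1 ->
    (forall x, X x -> reduced_ode alpha k r rho (similarity_var beta x)) <->
    (exists c3 c4 : C, forall x t, X x -> 0 < t ->
       cosh_profile beta q c3 x <> RtoC 0 /\ RtoC (u x t) = sol c3 c4 x t).

(* Main.v *)
Require Import Defs.
From Stdlib Require Import Reals Lra Classical FunctionalExtensionality.
From Coquelicot Require Import Coquelicot.
Open Scope R_scope.

(** Write z for the similarity variable x^beta / Gamma (1 + beta) and primes for
    d/dz.  The power rule at the matching order gives the derivative of z of
    order beta the value 1 / Gamma 1 = 1, so by the chain rule the fractional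
    derivative in x of a function of z is its ordinary derivative in z.  All
    the forms of u that occur are u = A Fa(t) + phi(z), with A constant, and
    for these the Burgers' equation is the identity
        A f = f (phi'' + k phi'^2)
    ([solves_burgers_separable]).  The similarity form has A = r / Gamma (1 + alpha)
    and phi = - A rho, which turns the identity into the reduced equation times
    A f.

    The reduced equation is a Riccati equation for rho'.  With
    q = k r / Gamma (1 + alpha), the substitution y = exp (- q rho) linearises
    it to y'' = q y, which the complex function w(z) = cosh (sqrt q (c3 + z))
    also satisfies.

    From the formula to the equation: reality of u says that the argument of w is a
    constant th.  Then |w| = cos th Re w + sin th Im w is itself a real positive
    solution of m'' = q m, and ln m satisfies (ln m)'' + (ln m)'^2 = q
    ([log_cosh_path_ode]).  One computation thus covers real and imaginary
    sqrt q and all complex c3.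

    From the equation to the formula: choose c3 so that w and y have the same
    logarithmic derivative p at one point.  As sqrt q tanh takes every value p
    with p^2 <> q, this is possible exactly off the singular solutions
    ([cosh_path_log_derivative_surj]).  The Wronskian of w and y then
    vanishes, so w is a complex constant times the positive function y: its
    argument is constant and its logarithm is - q rho plus a constant
    ([cosh_path_of_riccati]). *)

(** * The Gamma function on [1, 2) *)

Lemma increasing_bounded_limit_infty (G : R -> R) (M : R) :
  (forall x y, 0 < x < y -> G x < G y) -> (forall x, 0 < x -> G x <= M) ->
  exists l, filterlim G (Rbar_locally p_infty) (locally l).
Proof.
intros Hinc Hbound.
destruct (completeness (fun v => exists x, 0 < x /\ v = G x)) as [l [Hup Hleast]].
- exists M; intros v [x [Hx ->]]; auto.
- exists (G 1), 1; split; [lra | reflexivity].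
- exists l; apply filterlim_locally; intros eps.
  destruct (classic (exists x, 0 < x /\ l - eps < G x))
    as [[x [Hx Hlx]] | Hno].
  + exists x; intros y Hxy.
    assert (G y <= l) by (apply Hup; exists y; split; [lra | reflexivity]).
    assert (G x < G y) by (apply Hinc; lra).
    apply Rabs_lt_between'; pose proof (cond_pos eps); lra.
  + assert (l <= l - eps); [|pose proof (cond_pos eps); lra].
    apply Hleast; intros v [x [Hx ->]].
    apply Rnot_lt_le; intros Hlt; apply Hno; exists x; split; assumption.
Qed.

Lemma increasing_bounded_limit_0 (G : R -> R) (m : R) :
  (forall x y, 0 < x < y -> G x < G y) -> (forall x, 0 < x -> m <= G x) ->
  exists l, filterlim G (at_right 0) (locally l).
Proof.
intros Hinc Hbound.
destruct (increasing_bounded_limit_infty (fun x => - G (/ x)) (- m)) as [l Hl].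
- intros x y Hxy; apply Ropp_lt_contravar, Hinc; split.
  + apply Rinv_0_lt_compat; lra.
  + apply Rinv_lt_contravar; [apply Rmult_lt_0_compat|]; lra.
- intros x Hx; apply Ropp_le_contravar, Hbound, Rinv_0_lt_compat, Hx.
- exists (- l).
  apply (filterlim_ext_loc (fun x => - - G (/ / x))).
  + exists (mkposreal 1 Rlt_0_1); intros y _ Hy; rewrite Rinv_inv; ring.
  + apply (filterlim_comp _ _ _ (fun x => - G (/ / x)) Ropp _ (locally l)).
    * apply (filterlim_comp _ _ _ Rinv (fun x => - G (/ x)) _ (Rbar_locally p_infty));
        [apply filterlim_Rinv_0_right | exact Hl].
    * apply (filterlim_opp l).
Qed.

(** The primitive is only controlled on the open half-line, where the value of
    the doubly improper integral is the difference of its two limits. *)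
Lemma RInt_gen_0_infty_primitive (f G : R -> R) (l0 l1 : R) :
  (forall t, 0 < t -> is_derive G t (f t)) ->
  (forall t, 0 < t -> continuous f t) ->
  filterlim G (at_right 0) (locally l0) ->
  filterlim G (Rbar_locally p_infty) (locally l1) ->
  RInt_gen f (at_right 0) (Rbar_locally p_infty) = l1 - l0.
Proof.
intros HG Hf H0 H1; apply is_RInt_gen_unique.
assert (Hpos : filter_prod (at_right 0) (Rbar_locally p_infty)
   (fun ab : R * R => forall x, Rmin (fst ab) (snd ab) <= x -> 0 < x)).
{ exists (fun x => 0 < x) (fun x => 0 < x).
  - exists (mkposreal 1 Rlt_0_1); auto.
  - exists 0; auto.
  - intros x y Hx Hy z; simpl; apply Rlt_le_trans, Rmin_pos; assumption. }
apply (is_RInt_gen_ext (Derive G)).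
- (eapply filter_imp; [|exact Hpos]; intros [x y] Hx z [Hz _]).
  apply is_derive_unique, HG, Hx, Rlt_le, Hz.
- apply is_RInt_gen_Derive; try assumption;
    (eapply filter_imp; [|exact Hpos]; intros [x y] Hx z [Hz _]).
  + exists (f z); apply HG, (Hx _ Hz).
  + specialize (Hx _ Hz).
    apply (continuous_ext_loc _ f); [|exact (Hf z Hx)].
    exists (mkposreal z Hx); intros w Hw; symmetry; apply is_derive_unique, HG.
    apply Rabs_lt_between' in Hw; simpl in Hw; lra.
Qed.

Lemma Gamma_1 : Gamma 1 = 1.
Proof.
unfold Gamma.
rewrite (RInt_gen_0_infty_primitive _ (fun t => - exp (- t)) (-1) 0); [ring| | | |].
- intros t Ht; replace (1 - 1) with 0 by ring; rewrite Rpower_O by exact Ht.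
  auto_derive; [exact I | ring].
- intros t Ht.
  apply (continuous_ext_loc _ (fun t => exp (- t))).
  + exists (mkposreal t Ht); intros w Hw.
    apply Rabs_lt_between' in Hw; simpl in Hw.
    replace (1 - 1) with 0 by ring; rewrite Rpower_O; lra.
  + apply (ex_derive_continuous (V := R_NormedModule)); auto_derive; exact I.
- intros P HP; apply filter_le_within.
  apply (ex_derive_continuous (V := R_NormedModule) (fun t => - exp (- t)) 0).
  + auto_derive; exact I.
  + rewrite Ropp_0, exp_0; exact HP.
- rewrite <- Ropp_0.
  apply (filterlim_comp _ _ _ (fun t => exp (- t)) Ropp _ (locally 0));
    [|apply (filterlim_opp 0)].
  apply (filterlim_comp _ _ _ Ropp exp _ (Rbar_locally m_infty));
    [apply (filterlim_Rbar_opp p_infty) | apply is_lim_exp_m].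
Qed.

Lemma Rpower_lt_1_plus (a t : R) : 0 < a < 1 -> 0 < t -> Rpower t a < 1 + t.
Proof.
intros Ha Ht; destruct (Rle_lt_dec t 1) as [Ht1 | Ht1].
- apply Rle_lt_trans with (Rpower 1 a); [apply Rle_Rpower_l; lra|].
  unfold Rpower; rewrite ln_1, Rmult_0_r, exp_0; lra.
- apply Rlt_trans with (Rpower t 1); [apply Rpower_lt; lra|].
  rewrite Rpower_1; lra.
Qed.

(** The total function [Gamma] has a meaningful value only if its integral
    converges.  Convergence follows from t^a < 1 + t, since (1 + t) e^(-t) has
    the bounded primitive - (2 + t) e^(-t); positivity is then monotonicity of
    the primitive. *)
Lemma Gamma_1_plus_pos (a : R) : 0 < a < 1 -> 0 < Gamma (1 + a).
Proof.
intros Ha; unfold Gamma.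
set (f := fun t => Rpower t (1 + a - 1) * exp (- t)).
assert (Hf : forall t, 0 < t -> 0 < f t < (1 + t) * exp (- t)).
{ intros t Ht; unfold f; replace (1 + a - 1) with a by ring.
  pose proof (exp_pos (- t)); split.
  - apply Rmult_lt_0_compat; [apply exp_pos | assumption].
  - apply Rmult_lt_compat_r; [|apply Rpower_lt_1_plus]; assumption. }
assert (Hc : forall t, 0 < t -> continuous f t).
{ intros t Ht; apply (ex_derive_continuous (V := R_NormedModule)).
  unfold f, Rpower; auto_derive; exact Ht. }
set (G := fun x => RInt f 1 x).
assert (HG : forall t, 0 < t -> is_derive G t (f t)).
{ intros t Ht; apply (is_derive_RInt f G 1); [|exact (Hc t Ht)].
  exists (mkposreal t Ht); intros y Hy; apply (RInt_correct f), ex_RInt_continuous.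
  apply Rabs_lt_between' in Hy; simpl in Hy.
  intros z [Hz _]; apply Hc.
  apply Rlt_le_trans with (2 := Hz), Rmin_pos; lra. }
assert (Hinc : forall x y, 0 < x < y -> G x < G y).
{ intros x y Hxy; apply (incr_function G 0 p_infty f); simpl; try tauto.
  - intros z Hz _; exact (HG z Hz).
  - intros z Hz _; apply Hf, Hz. }
set (H := fun x => - (2 + x) * exp (- x)).
(* [H] grows faster than [G] and has bounded range, so it bounds [G] on both
   sides of 1. *)
assert (Hcmp : forall x y, 0 < x < y -> H x - G x < H y - G y).
{ intros x y Hxy.
  apply (incr_function (fun x => H x - G x) 0 p_infty
           (fun t => (1 + t) * exp (- t) - f t)); simpl; try tauto.
  - intros z Hz _; apply (is_derive_minus H G z); [|exact (HG z Hz)].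
    unfold H; auto_derive; [exact I | ring].
  - intros z Hz _; pose proof (Hf z Hz); lra. }
assert (HH : forall x, 0 < x -> -2 < H x < 0).
{ assert (HH' : forall x, 0 < x -> 0 < (2 + x) * exp (- x) < 2).
  { intros x Hx; pose proof (exp_pos (- x)); split.
    - apply Rmult_lt_0_compat; lra.
    - assert (HH0 : 2 + x < 2 * exp x).
      { pose proof (exp_ineq1 x ltac:(lra)); lra. }
      apply (Rmult_lt_compat_r (exp (- x))) in HH0; [|assumption].
      rewrite Rmult_assoc, <- exp_plus, Rplus_opp_r, exp_0 in HH0; lra. }
  intros x Hx; pose proof (HH' x Hx); unfold H; lra. }
assert (HG1 : G 1 = 0) by apply (RInt_point (V := R_CompleteNormedModule)).
assert (HB : forall x, 0 < x -> -2 <= G x <= 2).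
{ intros x Hx; pose proof (HH x Hx); pose proof (HH 1 ltac:(lra)).
  destruct (Rtotal_order x 1) as [Hx1 | [-> | Hx1]]; [|lra|].
  - pose proof (Hinc x 1 ltac:(lra)); pose proof (Hcmp x 1 ltac:(lra)); lra.
  - pose proof (Hinc 1 x ltac:(lra)); pose proof (Hcmp 1 x ltac:(lra)); lra. }
destruct (increasing_bounded_limit_infty G 2 Hinc) as [l1 Hl1]; [apply HB|].
destruct (increasing_bounded_limit_0 G (-2) Hinc) as [l0 Hl0]; [apply HB|].
rewrite (RInt_gen_0_infty_primitive f G l0 l1); try assumption.
assert (l0 <= G 1).
{ apply (filterlim_le (F := at_right 0) G (fun _ => G 1) l0 (G 1)).
  - exists (mkposreal 1 Rlt_0_1); intros y Hy Hy0.
    apply Rabs_lt_between' in Hy; simpl in Hy; apply Rlt_le, Hinc; lra.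
  - exact Hl0.
  - apply filterlim_const. }
assert (G 2 <= l1).
{ apply (filterlim_le (F := Rbar_locally p_infty) (fun _ => G 2) G (G 2) l1).
  - exists 2; intros y Hy; apply Rlt_le, Hinc; lra.
  - apply filterlim_const.
  - exact Hl1. }
pose proof (Hinc 1 2 ltac:(lra)); lra.
Qed.

(** * The similarity variable as a coordinate *)

Definition similarity_inv (beta z : R) : R :=
  Rpower (z * Gamma (1 + beta)) (/ beta).

Definition similarity_image (beta : R) (X : R -> Prop) (z : R) : Prop :=
  exists x, X x /\ similarity_var beta x = z.

Lemma pw_pos (b x : R) : 0 < x -> pw b x = Rpower x b.
Proof. intros Hx; unfold pw; destruct (Rlt_dec 0 x); [reflexivity | lra]. Qed.

Lemma similarity_var_pos (beta x : R) :
  0 < beta < 1 -> 0 < x -> 0 < similarity_var beta x.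
Proof.
intros Hb Hx; unfold similarity_var; rewrite pw_pos by exact Hx.
apply Rdiv_lt_0_compat; [apply exp_pos | apply Gamma_1_plus_pos, Hb].
Qed.

Lemma similarity_varK (beta x : R) :
  0 < beta < 1 -> 0 < x -> similarity_inv beta (similarity_var beta x) = x.
Proof.
intros Hb Hx; unfold similarity_inv, similarity_var; rewrite pw_pos by exact Hx.
pose proof (Gamma_1_plus_pos beta Hb).
unfold Rdiv; rewrite Rmult_assoc, Rinv_l, Rmult_1_r, Rpower_mult by lra.
rewrite Rinv_r, Rpower_1; lra.
Qed.

Lemma similarity_invK (beta z : R) :
  0 < beta < 1 -> 0 < z -> similarity_var beta (similarity_inv beta z) = z.
Proof.
intros Hb Hz; unfold similarity_inv, similarity_var.
pose proof (Gamma_1_plus_pos beta Hb).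
rewrite pw_pos by apply exp_pos.
rewrite Rpower_mult, Rinv_l, Rpower_1.
- field; lra.
- apply Rmult_lt_0_compat; assumption.
- lra.
Qed.

Lemma similarity_inv_le (beta y z : R) :
  0 < beta < 1 -> 0 < y <= z -> similarity_inv beta y <= similarity_inv beta z.
Proof.
intros Hb Hyz; pose proof (Gamma_1_plus_pos beta Hb).
apply Rle_Rpower_l; [apply Rlt_le, Rinv_0_lt_compat; lra | split].
- apply Rmult_lt_0_compat; lra.
- apply Rmult_le_compat_r; lra.
Qed.

Lemma similarity_image_open (beta : R) (X : R -> Prop) :
  0 < beta < 1 -> space_domain X -> open (similarity_image beta X).
Proof.
intros Hb [HXo HXp] z [x [Hx <-]].
pose proof (similarity_var_pos beta x Hb (HXp x Hx)) as Hz.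
pose proof (Gamma_1_plus_pos beta Hb) as HG.
assert (Hc : continuous (similarity_inv beta) (similarity_var beta x)).
{ apply (ex_derive_continuous (V := R_NormedModule)).
  unfold similarity_inv, Rpower; auto_derive; apply Rmult_lt_0_compat; assumption. }
assert (HX : locally (similarity_inv beta (similarity_var beta x)) X).
{ rewrite similarity_varK; auto. }
assert (Hpos : locally (similarity_var beta x) (fun w => 0 < w)) by exact (open_gt 0 _ Hz).
assert (HX' : locally (similarity_var beta x) (fun w => X (similarity_inv beta w)))
  by exact (Hc X HX).
eapply filter_imp; [|exact (filter_and _ _ HX' Hpos)].
intros w [Hw Hw0]; exists (similarity_inv beta w); split; [exact Hw|].
apply similarity_invK; assumption.
Qed.

Lemma similarity_image_interval (beta : R) (X : R -> Prop) :
  0 < beta < 1 -> space_domain X -> interval_like X ->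
  interval_like (similarity_image beta X).
Proof.
intros Hb [_ HXp] HXi z1 z z2 [x1 [Hx1 <-]] [x2 [Hx2 <-]] Hz.
pose proof (similarity_var_pos beta x1 Hb (HXp x1 Hx1)) as Hz1.
exists (similarity_inv beta z); split; [|apply similarity_invK; lra].
apply (HXi x1 _ x2 Hx1 Hx2).
rewrite <- (similarity_varK beta x1 Hb (HXp x1 Hx1)).
rewrite <- (similarity_varK beta x2 Hb (HXp x2 Hx2)).
split; apply similarity_inv_le; lra.
Qed.

(** * Fractional derivatives of functions of the similarity variable *)

(** The factor Gamma (1 + beta) of the power rule cancels the normalisation of
    the variable and leaves 1 / Gamma 1. *)
Lemma calculus_similarity_var D (beta x : R) :
  jumarie_power_rule -> jumarie_calculus D -> 0 < beta < 1 -> 0 < x ->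
  D beta (similarity_var beta) x 1.
Proof.
intros HP HD Hb Hx; pose proof (Gamma_1_plus_pos beta Hb) as HG.
pose proof (jc_jumarie D HD beta x _ Hb Hx (HP beta beta x Hb (proj1 Hb) Hx)) as Hpw.
replace (1 + beta - beta) with 1 in Hpw by ring.
rewrite Gamma_1, pw_pos, Rminus_diag, Rpower_O in Hpw by exact Hx.
replace 1 with (/ Gamma (1 + beta) * (Gamma (1 + beta) / 1 * 1)) by (field; lra).
apply (jc_chain D HD beta (fun v => v / Gamma (1 + beta))); try assumption.
auto_derive; [exact I | field; lra].
Qed.

Lemma calculus_comp D (beta x l : R) (h : R -> R) :
  jumarie_power_rule -> jumarie_calculus D -> 0 < beta < 1 -> 0 < x ->
  is_derive h (similarity_var beta x) l ->
  D beta (fun y => h (similarity_var beta y)) x l.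
Proof.
intros HP HD Hb Hx Hh; rewrite <- (Rmult_1_r l).
apply (jc_chain D HD); try assumption.
apply calculus_similarity_var; assumption.
Qed.

(** Locality is not among the rules, but the product rule implies it.  The
    indicator b of the set where h1 = h2, seen as a function of the similarity
    variable, is locally constant at x, so it has derivative 0 there; hence
    b h1 = b h2 has both l1 and l2 as derivative. *)
Lemma calculus_local D (beta x l1 l2 : R) (X : R -> Prop) (h1 h2 : R -> R) :
  jumarie_power_rule -> jumarie_calculus D -> 0 < beta < 1 ->
  space_domain X -> X x -> (forall y, X y -> h1 y = h2 y) ->
  D beta h1 x l1 -> D beta h2 x l2 -> l1 = l2.
Proof.
intros HP HD Hb HX Hx Heq H1 H2.
pose proof (proj2 HX x Hx) as Hx0.
set (b := fun z => if Rlt_dec 0 z then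
  if Req_dec_T (h1 (similarity_inv beta z)) (h2 (similarity_inv beta z)) then 1 else 0
  else 0).
assert (Hb1 : forall y, X y -> b (similarity_var beta y) = 1).
{ intros y Hy; unfold b.
  pose proof (proj2 HX y Hy) as Hy0.
  destruct (Rlt_dec 0 (similarity_var beta y)) as [_|n];
    [|destruct n; apply similarity_var_pos; assumption].
  rewrite similarity_varK by assumption.
  destruct Req_dec_T as [_|n]; [reflexivity | destruct n; auto]. }
assert (Hbd : D beta (fun s => b (similarity_var beta s)) x 0).
{ apply calculus_comp; try assumption.
  apply (is_derive_ext_loc (fun _ => 1));
    [|apply (is_derive_const (V := R_NormedModule) 1)].
  eapply filter_imp; [|apply (similarity_image_open beta X Hb HX); exists x; auto].
  intros z [y [Hy <-]]; symmetry; auto. }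
pose proof (jc_product D HD beta _ _ x _ _ Hb Hx0 Hbd H1) as P1.
pose proof (jc_product D HD beta _ _ x _ _ Hb Hx0 Hbd H2) as P2.
cbv beta in P1, P2; rewrite Hb1 in P1, P2 by exact Hx.
rewrite Rmult_0_l, Rplus_0_l, Rmult_1_l in P1, P2.
refine (jc_unique D HD beta _ x l1 l2 Hb Hx0 _ P2).
refine (jc_ext D HD beta _ _ x l1 Hb Hx0 _ P1); intros s Hs.
unfold b; destruct (Rlt_dec 0 (similarity_var beta s)) as [Hp|]; [|ring].
assert (0 < s).
{ destruct Hs as [Hs | <-]; [exact Hs|].
  unfold similarity_var, pw in Hp; destruct (Rlt_dec 0 0); lra. }
rewrite similarity_varK by assumption.
destruct Req_dec_T as [e|]; [rewrite e|]; ring.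
Qed.

(** The function u_x^(beta) in [solves_burgers] is prescribed only on X, while
    its own derivative is taken of a function on the whole line; [calculus_local] shows
    that the second derivative is nevertheless determined. *)
Lemma solves_burgers_separable D (alpha beta k A : R) (f g Fa phi : R -> R)
    (X : R -> Prop) (u : R -> R -> R) :
  jumarie_power_rule -> jumarie_calculus D -> 0 < alpha < 1 -> 0 < beta < 1 ->
  (forall t, 0 < t -> g t = k * f t) ->
  (forall t, 0 < t -> D alpha Fa t (f t)) ->
  space_domain X ->
  (forall x t, 0 <= x -> 0 <= t -> u x t = A * Fa t + phi (similarity_var beta x)) ->
  (forall x, X x -> twice_derivable_at phi (similarity_var beta x)) ->
  solves_burgers D alpha beta f g X u <->
  (forall x t, X x -> 0 < t ->
     A * f t = f t * (Derive_n phi 2 (similarity_var beta x) +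
                      k * Derive phi (similarity_var beta x) ^ 2)).
Proof.
intros HP HD Ha Hb Hg HFa HX Hu Hphi.
assert (Hux : forall x t, X x -> 0 < t ->
  D beta (fun y => u y t) x (Derive phi (similarity_var beta x))).
{ intros x t Hx Ht; pose proof (proj2 HX x Hx) as Hx0.
  apply (jc_ext D HD beta (fun y => A * Fa t + phi (similarity_var beta y)));
    try assumption.
  - intros s Hs; rewrite Hu; lra.
  - apply (calculus_comp D beta x _ (fun z => A * Fa t + phi z)); try assumption.
    auto_derive; [apply Hphi, Hx | apply Rmult_1_l]. }
assert (Huxx : forall x, X x ->
  D beta (fun y => Derive phi (similarity_var beta y)) x
    (Derive_n phi 2 (similarity_var beta x))).
{ intros x Hx; apply calculus_comp; try assumption; [apply (proj2 HX x Hx)|].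
  apply Derive_correct, Hphi, Hx. }
assert (Hut : forall x t, X x -> 0 < t -> D alpha (fun s => u x s) t (A * f t)).
{ intros x t Hx Ht; pose proof (proj2 HX x Hx) as Hx0.
  apply (jc_ext D HD alpha (fun s => A * Fa s + phi (similarity_var beta x)));
    try assumption.
  - intros s Hs; rewrite Hu; lra.
  - apply (jc_chain D HD alpha (fun v => A * v + phi (similarity_var beta x)));
      try assumption; [auto_derive; [exact I | ring] | apply HFa, Ht]. }
split.
- intros [ux Hsol] x t Hx Ht.
  pose proof (proj2 HX x Hx) as Hx0.
  destruct (Hsol x t Hx Ht) as [_ [uxx [ut [Hxx [Ht' Heq]]]]].
  assert (Huxe : forall y, X y -> ux y t = Derive phi (similarity_var beta y)).
  { intros y Hy; apply (jc_unique D HD beta (fun y => u y t) y); try assumption.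
    - apply (proj2 HX y Hy).
    - apply Hsol; assumption.
    - apply Hux; assumption. }
  rewrite (jc_unique D HD alpha _ t _ _ Ha Ht (Hut x t Hx Ht) Ht'), Heq.
  rewrite (calculus_local D beta x _ _ X _ _ HP HD Hb HX Hx Huxe Hxx (Huxx x Hx)).
  rewrite Huxe, Hg by assumption; ring.
- intros Hode; exists (fun x _ => Derive phi (similarity_var beta x)).
  intros x t Hx Ht; split; [apply Hux; assumption|].
  exists (Derive_n phi 2 (similarity_var beta x)), (A * f t).
  split; [apply Huxx, Hx | split; [apply Hut; assumption|]].
  rewrite (Hode x t Hx Ht), Hg by assumption; ring.
Qed.

(** * The linear equation y'' = q y *)

Lemma constant_on_interval (Z : R -> Prop) (h : R -> R) :
  interval_like Z -> (forall z, Z z -> is_derive h z 0) ->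
  forall z1 z2, Z z1 -> Z z2 -> h z1 = h z2.
Proof.
intros HZ Hh z1 z2 H1 H2.
destruct (Rtotal_order z1 z2) as [Hlt | [-> | Hlt]]; [|reflexivity|symmetry];
  apply (eq_is_derive h); try exact Hlt; intros t Ht; apply Hh.
- exact (HZ z1 t z2 H1 H2 Ht).
- exact (HZ z2 t z1 H2 H1 Ht).
Qed.

(** The Wronskian of a and y is constant; it is 0 by the condition at z0, and
    then a / y has derivative 0. *)
Lemma linear_ode_proportional (q z0 : R) (Z : R -> Prop) (a a1 y y1 : R -> R) :
  interval_like Z -> Z z0 ->
  (forall z, Z z -> is_derive a z (a1 z) /\ is_derive a1 z (q * a z)) ->
  (forall z, Z z -> is_derive y z (y1 z) /\ is_derive y1 z (q * y z)) ->
  (forall z, Z z -> 0 < y z) ->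
  y z0 * a1 z0 = y1 z0 * a z0 ->
  forall z, Z z -> a z = a z0 / y z0 * y z.
Proof.
intros HZ H0 Ha Hy Hpos Hw z Hz.
assert (Hwr : forall w, Z w -> y w * a1 w - y1 w * a w = 0).
{ intros w Hw'.
  rewrite (constant_on_interval Z (fun w => y w * a1 w - y1 w * a w) HZ) with (z2 := z0);
    [lra | | exact Hw' | exact H0].
  intros v Hv; destruct (Ha v Hv) as [A1 A2], (Hy v Hv) as [Y1 Y2].
  evar_last.
  - apply (is_derive_minus (fun w => y w * a1 w) (fun w => y1 w * a w) v).
    + apply (is_derive_mult y a1 v _ _ Y1 A2), Rmult_comm.
    + apply (is_derive_mult y1 a v _ _ Y2 A1), Rmult_comm.
  - unfold minus, plus, opp, mult; simpl; ring. }
assert (Hq : a z / y z = a z0 / y z0).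
{ apply (constant_on_interval Z (fun w => a w / y w) HZ); try assumption.
  intros v Hv; destruct (Ha v Hv) as [A1 _], (Hy v Hv) as [Y1 _].
  pose proof (Hpos v Hv); evar_last.
  - apply (is_derive_div a y v _ _ A1 Y1); lra.
  - pose proof (Hwr v Hv).
    replace (a1 v * y v - a v * y1 v) with (y v * a1 v - y1 v * a v) by ring.
    rewrite H1; field; lra. }
pose proof (Hpos z Hz); rewrite <- Hq; field; lra.
Qed.

(** With v = m' / m, the equation m'' = q m is the Riccati equation
    v' = q - v^2. *)
Lemma affine_log_ode (q A B z0 : R) (phi m m1 : R -> R) :
  locally z0 (fun z => 0 < m z /\ is_derive m z (m1 z) /\
    is_derive m1 z (q * m z) /\ phi z = A * ln (m z) + B) ->
  exists v, twice_derivable_at phi z0 /\ Derive phi z0 = A * v /\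
    Derive_n phi 2 z0 = A * (q - v ^ 2).
Proof.
intros H.
assert (Hd : forall z, locally z (fun z => 0 < m z /\ is_derive m z (m1 z) /\
    is_derive m1 z (q * m z) /\ phi z = A * ln (m z) + B) ->
    is_derive phi z (A * (m1 z / m z))).
{ intros z Hz; apply (is_derive_ext_loc (fun z => A * ln (m z) + B)).
  - eapply filter_imp; [|exact Hz]; intros w Hw; symmetry; apply Hw.
  - apply locally_singleton in Hz; destruct Hz as [Hm [H1 _]].
    auto_derive.
    + split; [exists (m1 z); exact H1 | split; [exact Hm | exact I]].
    + replace (Derive _ z) with (m1 z) by (symmetry; apply is_derive_unique, H1).
      field; lra. }
pose proof (locally_singleton _ _ H) as [Hm [H1 [H2 _]]].
assert (Hdd : is_derive (Derive phi) z0 (A * (q - (m1 z0 / m z0) ^ 2))).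
{ apply (is_derive_ext_loc (fun z => A * (m1 z / m z))).
  - eapply filter_imp; [|exact (locally_locally _ _ H)].
    intros w Hw; symmetry; apply is_derive_unique, Hd, Hw.
  - evar_last.
    + apply (is_derive_scal (fun z => m1 z / m z) z0 A).
      apply (is_derive_div m1 m z0 _ _ H2 H1); lra.
    + unfold mult; simpl; field; lra. }
exists (m1 z0 / m z0); split; [split|split].
- exists (A * (m1 z0 / m z0)); apply Hd, H.
- eexists; exact Hdd.
- apply is_derive_unique, Hd, H.
- apply is_derive_unique, Hdd.
Qed.

(** * The complex hyperbolic cosine along the real line *)

(** [cosh_profile] in the similarity coordinate, on the whole line, where the
    differential equation has constant coefficients. *)
Definition cosh_path (q : R) (c : C) (z : R) : C :=
  Ccosh (Csqrt q * (c + RtoC z))%C.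

Definition cosh_path' (q : R) (c : C) (z : R) : C :=
  let s := (Csqrt q * (c + RtoC z))%C in
  (Csqrt q * ((Cexp s - Cexp (- s)) / RtoC 2))%C.

(** Derivative of a complex function of a real variable, taken by components
    because the real and imaginary parts enter the real equations separately. *)
Definition is_Cderive (w : R -> C) (z : R) (l : C) : Prop :=
  is_derive (fun t => Re (w t)) z (Re l) /\ is_derive (fun t => Im (w t)) z (Im l).

Lemma Re_RtoC_mult (a : R) (w : C) : Re (RtoC a * w) = a * Re w.
Proof. unfold Re; simpl; ring. Qed.

Lemma Im_RtoC_mult (a : R) (w : C) : Im (RtoC a * w) = a * Im w.
Proof. unfold Im; simpl; ring. Qed.

Lemma Csqrt_sqr (q : R) : (Csqrt q * Csqrt q)%C = RtoC q.
Proof.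
unfold Csqrt, Cmult, RtoC; simpl; apply injective_projections; simpl.
- destruct (Rle_lt_dec 0 q).
  + rewrite (sqrt_neg_0 (- q)), sqrt_sqrt by lra; ring.
  + rewrite (sqrt_neg_0 q), sqrt_sqrt by lra; ring.
- destruct (Rle_lt_dec 0 q).
  + rewrite (sqrt_neg_0 (- q)) by lra; ring.
  + rewrite (sqrt_neg_0 q) by lra; ring.
Qed.

Lemma is_Cderive_Cexp (s c : C) (z : R) :
  is_Cderive (fun t => Cexp (s * (c + RtoC t))) z (s * Cexp (s * (c + RtoC z)))%C.
Proof.
destruct s as [s1 s2], c as [c1 c2]; split; unfold Cexp; simpl;
  auto_derive; try exact I; unfold Rminus; ring.
Qed.

Lemma is_Cderive_lin (u v : R -> C) (a b lu lv : C) (z : R) :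
  is_Cderive u z lu -> is_Cderive v z lv ->
  is_Cderive (fun t => (a * u t + b * v t)%C) z (a * lu + b * lv)%C.
Proof.
intros [U1 U2] [V1 V2]; destruct a as [a1 a2], b as [b1 b2]; split; simpl.
- evar_last.
  + apply (is_derive_plus (fun t => a1 * Re (u t) - a2 * Im (u t))
             (fun t => b1 * Re (v t) - b2 * Im (v t))).
    * apply (is_derive_minus (fun t => a1 * Re (u t)) (fun t => a2 * Im (u t)));
        apply is_derive_scal; eassumption.
    * apply (is_derive_minus (fun t => b1 * Re (v t)) (fun t => b2 * Im (v t)));
        apply is_derive_scal; eassumption.
  + reflexivity.
- evar_last.
  + apply (is_derive_plus (fun t => a1 * Im (u t) + a2 * Re (u t))
             (fun t => b1 * Im (v t) + b2 * Re (v t))).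
    * apply (is_derive_plus (fun t => a1 * Im (u t)) (fun t => a2 * Re (u t)));
        apply is_derive_scal; eassumption.
    * apply (is_derive_plus (fun t => b1 * Im (v t)) (fun t => b2 * Re (v t)));
        apply is_derive_scal; eassumption.
  + reflexivity.
Qed.

Lemma is_Cderive_ext (u v : R -> C) (l l' : C) (z : R) :
  (forall t, u t = v t) -> l = l' -> is_Cderive u z l -> is_Cderive v z l'.
Proof.
intros H <- [U1 U2]; split;
  [eapply is_derive_ext; [|exact U1] | eapply is_derive_ext; [|exact U2]];
  intros t; simpl; now rewrite H.
Qed.

Lemma RtoC_2_neq_0 : RtoC 2 <> RtoC 0.
Proof. intros H; apply RtoC_inj in H; lra. Qed.

Lemma Copp_mult_l (a b : C) : (- (a * b) = - a * b)%C.
Proof. ring. Qed.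

Lemma cosh_path_derive (q : R) (c : C) (z : R) :
  is_Cderive (cosh_path q c) z (cosh_path' q c z).
Proof.
refine (is_Cderive_ext _ _ _ _ z _ _ (is_Cderive_lin _ _ (/ RtoC 2) (/ RtoC 2) _ _ z
   (is_Cderive_Cexp (Csqrt q) c z) (is_Cderive_Cexp (- Csqrt q) c z))).
- intros t; unfold cosh_path, Ccosh; rewrite Copp_mult_l; field; apply RtoC_2_neq_0.
- unfold cosh_path'; cbv zeta; rewrite Copp_mult_l; field; apply RtoC_2_neq_0.
Qed.

Lemma cosh_path'_derive (q : R) (c : C) (z : R) :
  is_Cderive (cosh_path' q c) z (RtoC q * cosh_path q c z)%C.
Proof.
refine (is_Cderive_ext _ _ _ _ z _ _ (is_Cderive_lin _ _
   (Csqrt q / RtoC 2) (- (Csqrt q / RtoC 2)) _ _ z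
   (is_Cderive_Cexp (Csqrt q) c z) (is_Cderive_Cexp (- Csqrt q) c z))).
- intros t; unfold cosh_path'; cbv zeta; rewrite Copp_mult_l; field; apply RtoC_2_neq_0.
- unfold cosh_path, Ccosh; rewrite <- (Csqrt_sqr q), Copp_mult_l; field; apply RtoC_2_neq_0.
Qed.

Lemma Cmod_sqr (w : C) : Re w * Re w + Im w * Im w = Cmod w * Cmod w.
Proof.
unfold Cmod; rewrite sqrt_sqrt; [unfold Re, Im; ring|].
pose proof (pow2_ge_0 (fst w)); pose proof (pow2_ge_0 (snd w)); lra.
Qed.

(** * Polar form and logarithm *)

Lemma Carg_polar (w : C) : w <> RtoC 0 ->
  Re w = Cmod w * cos (Carg w) /\ Im w = Cmod w * sin (Carg w).
Proof.
intros Hw; apply Cmod_gt_0 in Hw; pose proof (Cmod_sqr w) as Hs.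
set (m := Cmod w) in *; set (x := Re w) in *; set (y := Im w) in *.
assert (Hsq : 1 - Rsqr (x / m) = Rsqr (y / m)).
{ unfold Rsqr; replace (x / m * (x / m)) with (1 - y * y / (m * m)); [field; lra|].
  replace (y * y) with (m * m - x * x) by lra; field; lra. }
assert (Hb : -1 <= x / m <= 1).
{ pose proof (Rle_0_sqr (y / m)).
  assert (Rsqr (x / m) <= Rsqr 1) by (rewrite Rsqr_1; lra).
  apply Rsqr_le_abs_0 in H0; rewrite Rabs_R1 in H0; apply Rabs_le_between in H0; lra. }
assert (Hsin : sin (acos (x / m)) = Rabs y / m).
{ rewrite sin_acos, Hsq, sqrt_Rsqr_abs by exact Hb.
  rewrite Rabs_div by lra; rewrite (Rabs_right m) by lra; reflexivity. }
unfold Carg; fold x y m; destruct (Rle_dec 0 y) as [Hy | Hy].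
- rewrite cos_acos, Hsin, Rabs_right by lra; split; field; lra.
- rewrite cos_neg, sin_neg, cos_acos, Hsin, Rabs_left by lra; split; field; lra.
Qed.

(** Positive scaling preserves the argument; this keeps the imaginary part of
    the logarithm constant when w is a constant times a positive function. *)
Lemma Carg_scal (y : R) (w : C) : 0 < y -> w <> RtoC 0 -> Carg (RtoC y * w) = Carg w.
Proof.
intros Hy Hw; apply Cmod_gt_0 in Hw; unfold Carg.
rewrite Cmod_mult, Cmod_R, Rabs_right by lra.
rewrite Re_RtoC_mult, Im_RtoC_mult.
replace (y * Re w / (y * Cmod w)) with (Re w / Cmod w) by (field; lra).
destruct (Rle_dec 0 (y * Im w)) as [H1 | H1], (Rle_dec 0 (Im w)) as [H2 | H2];
  try reflexivity; exfalso.
- apply H2; apply (Rmult_le_reg_l y); lra.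
- apply H1; apply Rmult_le_pos; lra.
Qed.

Lemma Cexp_plus (a b : C) : Cexp (a + b) = (Cexp a * Cexp b)%C.
Proof.
destruct a, b; unfold Cexp, Cmult; simpl; rewrite exp_plus, cos_plus, sin_plus.
apply injective_projections; simpl; ring.
Qed.

Lemma Cexp_0 : Cexp (RtoC 0) = RtoC 1.
Proof.
unfold Cexp, RtoC; simpl; rewrite exp_0, cos_0, sin_0.
apply injective_projections; simpl; ring.
Qed.

Lemma Cexp_Clog (w : C) : w <> RtoC 0 -> Cexp (Clog w) = w.
Proof.
intros Hw; destruct (Carg_polar w Hw) as [H1 H2]; unfold Cexp, Clog; simpl.
rewrite exp_ln by (apply Cmod_gt_0, Hw).
apply injective_projections; simpl; symmetry; assumption.
Qed.

(** * Logarithms of hyperbolic cosines and the Riccati equation *)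

(** A constant argument th makes the modulus a fixed real linear combination of
    the real and imaginary parts, hence a solution of the same linear
    equation. *)
Lemma log_cosh_path_ode (q A B th z0 : R) (c : C) (phi : R -> R) :
  locally z0 (fun z => cosh_path q c z <> RtoC 0 /\ Carg (cosh_path q c z) = th /\
    phi z = A * ln (Cmod (cosh_path q c z)) + B) ->
  exists v, twice_derivable_at phi z0 /\ Derive phi z0 = A * v /\
    Derive_n phi 2 z0 = A * (q - v ^ 2).
Proof.
intros H.
apply (affine_log_ode q A B z0 phi
  (fun z => cos th * Re (cosh_path q c z) + sin th * Im (cosh_path q c z))
  (fun z => cos th * Re (cosh_path' q c z) + sin th * Im (cosh_path' q c z))).
eapply filter_imp; [|exact H]; intros z [Hw [Harg Hphi]].
assert (Hm : cos th * Re (cosh_path q c z) + sin th * Im (cosh_path q c z)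
             = Cmod (cosh_path q c z)).
{ destruct (Carg_polar _ Hw) as [H1 H2]; rewrite Harg in H1, H2; rewrite H1, H2.
  pose proof (sin2_cos2 th) as Hsc; unfold Rsqr in Hsc.
  rewrite <- (Rmult_1_r (Cmod (cosh_path q c z))) at 3; rewrite <- Hsc; ring. }
destruct (cosh_path_derive q c z) as [D1 D2], (cosh_path'_derive q c z) as [D3 D4].
rewrite Hm; split; [apply Cmod_gt_0, Hw | split; [|split; [|exact Hphi]]].
- apply (is_derive_plus (fun z => cos th * Re (cosh_path q c z))
    (fun z => sin th * Im (cosh_path q c z))); apply is_derive_scal; assumption.
- evar_last.
  + apply (is_derive_plus (fun z => cos th * Re (cosh_path' q c z))
      (fun z => sin th * Im (cosh_path' q c z))); apply is_derive_scal; eassumption.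
  + rewrite <- Hm, Re_RtoC_mult, Im_RtoC_mult; unfold plus; simpl; ring.
Qed.

(** With s^2 = q, the equation s tanh h = p is e^(2h) = (s + p) / (s - p).  The
    right side is finite and nonzero because p^2 <> q, so half its logarithm is
    a solution h, and cosh h <> 0 because the ratio is -1 only for s = 0. *)
Lemma cosh_path_log_derivative_surj (q p z0 : R) : q <> 0 -> p ^ 2 <> q ->
  exists c, cosh_path q c z0 <> RtoC 0 /\
    cosh_path' q c z0 = (RtoC p * cosh_path q c z0)%C.
Proof.
intros Hq Hp; set (s := Csqrt q).
assert (Hs2 : (s * s)%C = RtoC q) by apply Csqrt_sqr.
assert (Hs0 : s <> RtoC 0).
{ intros E; rewrite E in Hs2; apply Hq, RtoC_inj; rewrite <- Hs2; ring. }
assert (Hpq : (s * s - RtoC p * RtoC p)%C <> RtoC 0).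
{ intros E; rewrite Hs2, <- RtoC_mult, <- RtoC_minus in E.
  apply RtoC_inj in E; apply Hp; lra. }
assert (Hm : (s - RtoC p)%C <> RtoC 0).
{ intros E; apply Hpq; replace (s * s - RtoC p * RtoC p)%C
    with ((s - RtoC p) * (s + RtoC p))%C by ring; rewrite E; ring. }
assert (Hpl : (s + RtoC p)%C <> RtoC 0).
{ intros E; apply Hpq; replace (s * s - RtoC p * RtoC p)%C
    with ((s - RtoC p) * (s + RtoC p))%C by ring; rewrite E; ring. }
set (e := ((s + RtoC p) / (s - RtoC p))%C).
assert (He : e <> RtoC 0).
{ intros E; apply Hpl; replace (s + RtoC p)%C with (e * (s - RtoC p))%C
    by (unfold e; field; exact Hm); rewrite E; ring. }
set (h := (Clog e / RtoC 2)%C).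
assert (Hh : (Cexp h * Cexp h)%C = e).
{ rewrite <- Cexp_plus; replace (h + h)%C with (Clog e)
    by (unfold h; field; apply RtoC_2_neq_0); apply Cexp_Clog, He. }
assert (Hi : (Cexp h * Cexp (- h))%C = RtoC 1).
{ rewrite <- Cexp_plus; replace (h + - h)%C with (RtoC 0) by ring; apply Cexp_0. }
assert (Hh0 : Cexp h <> RtoC 0).
{ intros E; apply He; rewrite <- Hh, E; ring. }
assert (Hih : Cexp (- h) = (/ Cexp h)%C).
{ rewrite <- (Cmult_1_l (Cexp (- h))), <- (Cinv_l (Cexp h) Hh0), <- Cmult_assoc, Hi; ring. }
exists (h / s - RtoC z0)%C; unfold cosh_path, cosh_path', Ccosh; cbv zeta; fold s.
replace (s * (h / s - RtoC z0 + RtoC z0))%C with h by (field; exact Hs0).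
assert (Hcosh : ((Cexp h + Cexp (- h)) / RtoC 2 = s / ((s - RtoC p) * Cexp h))%C).
{ rewrite Hih; replace (Cexp h + / Cexp h)%C with ((Cexp h * Cexp h + RtoC 1) / Cexp h)%C
    by (field; exact Hh0).
  rewrite Hh; unfold e; field; repeat split; try assumption; apply RtoC_2_neq_0. }
assert (Hsinh : ((Cexp h - Cexp (- h)) / RtoC 2 = RtoC p / ((s - RtoC p) * Cexp h))%C).
{ rewrite Hih; replace (Cexp h - / Cexp h)%C with ((Cexp h * Cexp h - RtoC 1) / Cexp h)%C
    by (field; exact Hh0).
  rewrite Hh; unfold e; field; repeat split; try assumption; apply RtoC_2_neq_0. }
rewrite Hcosh, Hsinh; split.
- intros E; apply Hs0.
  replace s with (s / ((s - RtoC p) * Cexp h) * ((s - RtoC p) * Cexp h))%C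
    by (field; split; assumption); rewrite E; ring.
- field; split; assumption.
Qed.

(** The comparison function y = exp (q (rho z0 - rho z)) solves the linearised
    equation.  It is normalised to y z0 = 1, so that the constant of
    proportionality between w and y is the value of w at z0. *)
Lemma cosh_path_of_riccati (q z0 : R) (Z : R -> Prop) (rho : R -> R) :
  q <> 0 -> interval_like Z -> Z z0 ->
  (forall z, Z z -> twice_derivable_at rho z /\
     Derive_n rho 2 z - q * Derive rho z ^ 2 + 1 = 0) ->
  q * Derive rho z0 ^ 2 <> 1 ->
  exists c, cosh_path q c z0 <> RtoC 0 /\ forall z, Z z ->
    cosh_path q c z = (RtoC (exp (q * (rho z0 - rho z))) * cosh_path q c z0)%C.
Proof.
intros Hq HZ H0 Hrho Hns.
set (y := fun z => exp (q * (rho z0 - rho z))).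
set (y1 := fun z => - q * Derive rho z * y z).
assert (Hy0 : y z0 = 1) by (unfold y; rewrite Rminus_diag, Rmult_0_r; apply exp_0).
assert (Hy : forall z, Z z -> is_derive y z (y1 z) /\ is_derive y1 z (q * y z)).
{ intros z Hz; destruct (Hrho z Hz) as [[Hd Hdd] Hode].
  assert (Hy1 : is_derive y z (y1 z)).
  { unfold y1, y; auto_derive; [exact Hd|]; unfold Rminus.
    change (Derive (fun x => rho x) z) with (Derive rho z).
    ring. }
  split; [exact Hy1|].
  evar_last.
  - apply (is_derive_mult (fun z => - q * Derive rho z) y z); [|exact Hy1 | apply Rmult_comm].
    apply is_derive_scal, Derive_correct, Hdd.
  - unfold plus, mult; simpl; unfold y1.
    change (Derive_n rho 2 z) with (Derive (Derive rho) z) in Hode.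
    change (Derive (fun x => Derive rho x) z) with (Derive (Derive rho) z).
    replace (Derive (Derive rho) z) with (q * Derive rho z ^ 2 - 1) by lra; ring. }
destruct (cosh_path_log_derivative_surj q (- q * Derive rho z0) z0 Hq) as [c [Hc Hc']].
{ intros E; apply Hns, (Rmult_eq_reg_l q); [|exact Hq].
  rewrite Rmult_1_r; etransitivity; [|exact E]; ring. }
exists c; split; [exact Hc|]; intros z Hz.
assert (Hpos : forall w, Z w -> 0 < y w) by (intros; apply exp_pos).
fold (y z); apply injective_projections.
- change (Re (cosh_path q c z) = Re (RtoC (y z) * cosh_path q c z0)%C).
  rewrite (linear_ode_proportional q z0 Z (fun w => Re (cosh_path q c w))
    (fun w => Re (cosh_path' q c w)) y y1 HZ H0) with (z := z); try assumption.
  + rewrite Hy0, Re_RtoC_mult; field.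
  + intros w Hw; split; [exact (proj1 (cosh_path_derive q c w))|].
    rewrite <- Re_RtoC_mult; exact (proj1 (cosh_path'_derive q c w)).
  + cbv beta; rewrite Hc', Re_RtoC_mult; unfold y1; rewrite Hy0; ring.
- change (Im (cosh_path q c z) = Im (RtoC (y z) * cosh_path q c z0)%C).
  rewrite (linear_ode_proportional q z0 Z (fun w => Im (cosh_path q c w))
    (fun w => Im (cosh_path' q c w)) y y1 HZ H0) with (z := z); try assumption.
  + rewrite Hy0, Im_RtoC_mult; field.
  + intros w Hw; split; [exact (proj2 (cosh_path_derive q c w))|].
    rewrite <- Im_RtoC_mult; exact (proj2 (cosh_path'_derive q c w)).
  + cbv beta; rewrite Hc', Im_RtoC_mult; unfold y1; rewrite Hy0; ring.
Qed.

(** * The general solution *)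

Lemma burgers_solution_r_parts (alpha beta k r : R) (Fa : R -> R) (c3 c4 : C) (x t : R) :
  let w := cosh_path (k * r / Gamma (1 + alpha)) c3 (similarity_var beta x) in
  Re (burgers_solution_r alpha beta k r Fa c3 c4 x t)
    = r / Gamma (1 + alpha) * Fa t + 1 / k * ln (Cmod w) - Re c4 /\
  Im (burgers_solution_r alpha beta k r Fa c3 c4 x t) = 1 / k * Carg w - Im c4.
Proof.
intros w; unfold burgers_solution_r; change (cosh_profile _ _ _ _) with w.
unfold Clog; split; unfold Re, Im; simpl; ring.
Qed.

Lemma burgers_solution_r_at_Gamma (alpha beta k r : R) (Fa : R -> R) :
  0 < alpha < 1 -> r = Gamma (1 + alpha) ->
  k * r / Gamma (1 + alpha) = k /\
  burgers_solution_r alpha beta k r Fa = burgers_solution beta k Fa.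
Proof.
intros Ha ->; pose proof (Gamma_1_plus_pos alpha Ha) as HG.
assert (E : k * Gamma (1 + alpha) / Gamma (1 + alpha) = k) by (field; lra).
split; [exact E|].
unfold burgers_solution_r, burgers_solution; rewrite E, Rdiv_diag by lra.
apply functional_extensionality; intros c3.
apply functional_extensionality; intros c4.
apply functional_extensionality; intros x.
apply functional_extensionality; intros t.
rewrite Rmult_1_l; reflexivity.
Qed.

Lemma burgers_solution_r_general (alpha beta k r : R) (Fa : R -> R) :
  0 < alpha < 1 -> 0 < beta < 1 -> k <> 0 -> r <> 0 ->
  is_general_solution alpha beta k r (k * r / Gamma (1 + alpha)) Fa
    (burgers_solution_r alpha beta k r Fa).
Proof.
intros Ha Hb Hk Hr X u rho x0 HX HXi Hform Hrho Hx0 Hns.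
pose proof (Gamma_1_plus_pos alpha Ha) as HG.
set (q := k * r / Gamma (1 + alpha)) in *.
assert (Hq : q <> 0).
{ unfold q, Rdiv; repeat apply Rmult_integral_contrapositive_currified; try assumption.
  apply Rinv_neq_0_compat; lra. }
split.
- intros Hode.
  set (z0 := similarity_var beta x0) in *.
  destruct (cosh_path_of_riccati q z0 (similarity_image beta X) rho Hq) as [c3 [Hc3 Hw]].
  + apply similarity_image_interval; assumption.
  + exists x0; auto.
  + intros z [x [Hx <-]]; split; [apply Hrho, Hx | apply Hode, Hx].
  + exact Hns.
  + (* The real part of c4 fixes the additive constant at z0, its imaginary part
       cancels the constant argument of w. *)
    exists c3, (1 / k * (q * rho z0 + ln (Cmod (cosh_path q c3 z0))),
                1 / k * Carg (cosh_path q c3 z0)).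
    intros x t Hx Ht.
    pose proof (Hw (similarity_var beta x) (ex_intro _ x (conj Hx eq_refl))) as Hwx.
    pose proof (exp_pos (q * (rho z0 - rho (similarity_var beta x)))) as He.
    split.
    * change (cosh_path q c3 (similarity_var beta x) <> RtoC 0); rewrite Hwx.
      apply Cmult_neq_0; [|exact Hc3].
      intros E; apply RtoC_inj in E; lra.
    * match goal with |- _ = burgers_solution_r _ _ _ _ _ _ ?c _ _ =>
        destruct (burgers_solution_r_parts alpha beta k r Fa c3 c x t) as [E1 E2] end.
      fold q in E1, E2; rewrite Hwx in E1, E2.
      rewrite Carg_scal in E2 by assumption.
      rewrite Cmod_mult, Cmod_R, Rabs_right, ln_mult, ln_exp in E1
        by (try apply Cmod_gt_0; try assumption; lra).
      apply injective_projections; [etransitivity; [|symmetry; exact E1] |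
        etransitivity; [|symmetry; exact E2]].
      -- pose proof (Hform x t (Rlt_le _ _ (proj2 HX x Hx)) (Rlt_le _ _ Ht)) as Hf.
         rewrite Hf; simpl; unfold q; field; repeat split; lra || assumption.
      -- simpl; ring.
- intros [c3 [c4 Hsol]] x Hx.
  (* The real part of the formula is solved for rho; the imaginary part fixes
     the argument of w.  Any positive time will do, since rho does not depend
     on it. *)
  assert (Hloc : locally (similarity_var beta x) (fun z =>
    cosh_path q c3 z <> RtoC 0 /\ Carg (cosh_path q c3 z) = k * Im c4 /\
    rho z = - / q * ln (Cmod (cosh_path q c3 z)) + Gamma (1 + alpha) / r * Re c4)).
  { eapply filter_imp; [|apply (similarity_image_open beta X Hb HX); exists x; auto].
    intros z [y [Hy <-]]; destruct (Hsol y 1 Hy Rlt_0_1) as [Hw Hu].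
    destruct (burgers_solution_r_parts alpha beta k r Fa c3 c4 y 1) as [E1 E2].
    rewrite <- Hu in E1, E2; fold q in E1, E2; simpl in E1, E2.
    split; [exact Hw | split].
    - replace (Im c4) with (1 / k * Carg (cosh_path q c3 (similarity_var beta y))) by lra.
      field; exact Hk.
    - rewrite (Hform y 1 (Rlt_le _ _ (proj2 HX y Hy)) Rle_0_1), E1.
      unfold q at 2; field; repeat split; lra || assumption. }
  destruct (log_cosh_path_ode q _ _ _ _ c3 rho Hloc) as [v [_ [E1 E2]]].
  unfold reduced_ode; fold q; rewrite E1, E2; field; exact Hq.
Qed.

Theorem theorem4p5 :
  forall (D : R -> (R -> R) -> R -> R -> Prop)
    (alpha beta k r : R) (f g F Fa : R -> R),
  jumarie_power_rule ->
  jumarie_calculus D ->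
  0 < alpha < 1 -> 0 < beta < 1 -> k <> 0 -> r <> 0 ->
  (forall t, 0 < t -> g t = k * f t) ->
  (* Fa = F_t^(alpha) and F_t^(2 alpha) = f *)
  (forall t, 0 < t -> D alpha F t (Fa t)) ->
  (forall t, 0 < t -> D alpha Fa t (f t)) ->
  (* the Burgers' equation reduces to the ordinary differential equation *)
  (forall (X : R -> Prop) (u : R -> R -> R) (rho : R -> R),
     space_domain X ->
     similarity_form alpha beta r Fa u rho ->
     (forall x, X x -> twice_derivable_at rho (similarity_var beta x)) ->
     ((forall x, X x -> reduced_ode alpha k r rho (similarity_var beta x)) ->
        solves_burgers D alpha beta f g X u) /\
     ((exists t, 0 < t /\ f t <> 0) ->
        solves_burgers D alpha beta f g X u ->
        forall x, X x -> reduced_ode alpha k r rho (similarity_var beta x))) /\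
  (* the stated family solves the Burgers' equation wherever it is defined
     and real *)
  (forall (c3 c4 : C) (X : R -> Prop),
     space_domain X ->
     (forall x t, X x -> 0 < t ->
        cosh_profile beta k c3 x <> RtoC 0 /\
        Im (burgers_solution beta k Fa c3 c4 x t) = 0) ->
     solves_burgers D alpha beta f g X
       (fun x t => Re (burgers_solution beta k Fa c3 c4 x t))) /\
  (* it is the general solution for the normalisation r = Gamma (1 + alpha) *)
  (r = Gamma (1 + alpha) ->
     is_general_solution alpha beta k r k Fa (burgers_solution beta k Fa)) /\
  (* and its rescaling is the general solution for arbitrary r *)
  is_general_solution alpha beta k r (k * r / Gamma (1 + alpha)) Fa
    (burgers_solution_r alpha beta k r Fa).
Proof.
intros D alpha beta k r f g F Fa HP HD Ha Hb Hk Hr Hg _ HFa.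
pose proof (Gamma_1_plus_pos alpha Ha) as HG.
split; [|split; [|split]].
- intros X u rho HX Hform Hrho.
  set (c := r / Gamma (1 + alpha)).
  assert (Hc : c <> 0).
  { apply Rmult_integral_contrapositive_currified; [exact Hr|].
    apply Rinv_neq_0_compat; lra. }
  assert (Hd : forall z, Derive (fun z => - c * rho z) z = - c * Derive rho z)
    by (intros z; apply Derive_scal).
  assert (Hdd : forall z, Derive_n (fun z => - c * rho z) 2 z = - c * Derive_n rho 2 z).
  { intros z; simpl; rewrite <- Derive_scal; apply Derive_ext; exact Hd. }
  assert (Hiff := solves_burgers_separable D alpha beta k c f g Fa
    (fun z => - c * rho z) X u HP HD Ha Hb Hg HFa HX).
  destruct Hiff as [Hto Hfrom].
  + intros x t Hx Ht; rewrite (Hform x t Hx Ht); unfold c; field; lra.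
  + intros x Hx; destruct (Hrho x Hx) as [H1 H2]; split.
    * apply ex_derive_scal, H1.
    * apply (ex_derive_ext (fun z => - c * Derive rho z)); [intros z; symmetry; apply Hd|].
      apply ex_derive_scal, H2.
  + assert (Hode : forall x, reduced_ode alpha k r rho (similarity_var beta x) <->
      c = Derive_n (fun z => - c * rho z) 2 (similarity_var beta x) +
          k * Derive (fun z => - c * rho z) (similarity_var beta x) ^ 2).
    { intros x; rewrite Hd, Hdd; unfold reduced_ode.
      replace (k * r / Gamma (1 + alpha)) with (k * c) by (unfold c; field; lra).
      split; intros E.
      - apply Rminus_diag_uniq; apply (Rmult_eq_compat_l c) in E; lra.
      - apply (Rmult_eq_reg_l c); [lra | exact Hc]. }
    split.
    * intros H; apply Hfrom; intros x t Hx _.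
      rewrite <- (proj1 (Hode x) (H x Hx)); ring.
    * intros [t [Ht Hft]] Hsol x Hx; apply Hode.
      apply (Rmult_eq_reg_l (f t)); [|exact Hft].
      rewrite <- (Hto Hsol x t Hx Ht); ring.
- intros c3 c4 X HX Hreal.
  set (L := fun z => 1 / k * ln (Cmod (cosh_path k c3 z)) + - Re c4).
  assert (HL : forall x, X x -> exists v, twice_derivable_at L (similarity_var beta x) /\
    Derive L (similarity_var beta x) = 1 / k * v /\
    Derive_n L 2 (similarity_var beta x) = 1 / k * (k - v ^ 2)).
  { intros x Hx.
    apply (log_cosh_path_ode k (1 / k) (- Re c4) (k * Im c4) _ c3).
    eapply filter_imp; [|apply (similarity_image_open beta X Hb HX); exists x; auto].
    intros z [y [Hy <-]]; destruct (Hreal y 1 Hy Rlt_0_1) as [Hw Him].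
    split; [exact Hw | split; [|reflexivity]].
    assert (E : Im (burgers_solution beta k Fa c3 c4 y 1)
      = 1 / k * Carg (cosh_path k c3 (similarity_var beta y)) - Im c4).
    { unfold burgers_solution; change (cosh_profile _ _ _ _)
        with (cosh_path k c3 (similarity_var beta y)).
      unfold Clog, Im; simpl; ring. }
    replace (Im c4) with (1 / k * Carg (cosh_path k c3 (similarity_var beta y))) by lra.
    field; exact Hk. }
  apply (solves_burgers_separable D alpha beta k 1 f g Fa L); try assumption.
  + intros x t _ _; unfold burgers_solution, L; change (cosh_profile _ _ _ _)
        with (cosh_path k c3 (similarity_var beta x)).
    unfold Clog, Re; simpl; ring.
  + intros x Hx; destruct (HL x Hx) as [v [H _]]; exact H.
  + intros x t Hx _; destruct (HL x Hx) as [v [_ [-> ->]]]; field; exact Hk.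
- intros E; destruct (burgers_solution_r_at_Gamma alpha beta k r Fa Ha E) as [E1 E2].
  rewrite <- E2; rewrite <- E1 at 2; apply burgers_solution_r_general; assumption.
- apply burgers_solution_r_general; assumption.
Qed.
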